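(* Let $k$ be an algebraically closed field of characteristic different from $2$ and $3$. Fix $M=3$ or $M=4$. Let $f,g\in k[T]$ with $\deg(f)=2M$ and $\deg(g)=3M$. Then $f^3\neq g^2$ implies $\deg(f^3-g^2)\ge M+1$. Moreover, up to affine transformations of $T$ (that is, $T\mapsto \alpha T+\beta$ with $\alpha\in k\setminus\{0\}$, $\beta\in k$) and scaling (that is, $(f,g)\mapsto(c^2f,c^3g)$ with $c\in k\setminus\{0\}$), there exists exactly one pair $(f,g)$ of polynomials in $k[T]$ with $\deg(f)=2M$, $\deg(g)=3M$ and $\deg(f^3-g^2)=M+1$. *)

(* Defs.v *)
From HB Require Import structures.
From mathcomp Require Import all_boot all_algebra.

Set Implicit Arguments.
Unset Strict Implicit.
Unset Printing Implicit Defensive.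

Import GRing.Theory.

Local Open Scope ring_scope.

(* [has_deg p d]: p is nonzero of degree d; [size p] is deg p + 1 for p != 0,
   and [size 0 = 0], so the zero polynomial has no degree. *)
Definition has_deg (k : fieldType) (p : {poly k}) (d : nat) : Prop :=
  size p = d.+1.

Definition extremal_pair (k : fieldType) (M : nat) (fg : {poly k} * {poly k})
    : Prop :=
  [/\ has_deg fg.1 (2 * M), has_deg fg.2 (3 * M)
    & has_deg (fg.1 ^+ 3 - fg.2 ^+ 2) M.+1].

(* The substitutions T |-> a T + b and the scalings (f, g) |-> (c^2 f, c^3 g)
   commute, so an orbit of the group they generate consists of the pairs
   obtained by one substitution followed by one scaling. *)
Definition affine_scaling_equiv (k : fieldType)
    (fg fg' : {poly k} * {poly k}) : Prop :=
  exists a b c : k,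
    [/\ a != 0, c != 0,
        fg'.1 = c ^+ 2 *: (fg.1 \Po (a *: 'X + b%:P))
      & fg'.2 = c ^+ 3 *: (fg.2 \Po (a *: 'X + b%:P))].

(* Main.v *)
Require Import Defs.
From mathcomp Require Import all_boot all_algebra.
From mathcomp Require Import ring zify.
Set Implicit Arguments.
Unset Strict Implicit.
Unset Printing Implicit Defensive.
Import GRing.Theory.
Local Open Scope ring_scope.

(** After scaling, f and g are monic, and f = h^2 + 2r with deg h = M and
    deg r < M. Write g = h^3 + 3rh + s and e = 3r^2 - 2sh. Then
      f^3 - g^2 = h^2 e - r^3 + 3re - s^2,
    so deg (f^3 - g^2) <= M + 1 forces deg s <= M - 2 and deg e <= M - 3: it
    becomes a small triangular system in the coefficients of h, r, s and e. Once
    a translation has killed the coefficient of T^(M-1) in h, the solutions are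
    r = s = 0, where f^3 = g^2, and a single orbit under T |-> aT, on which
    f^3 - g^2 has degree exactly M + 1. *)

(** * Coefficient lists and elimination *)

Lemma Poly_mkseq_coef (R : nzSemiRingType) (p : {poly R}) (n : nat) :
  (size p <= n)%N -> p = Poly (mkseq (nth 0 p) n).
Proof.
move=> le_p_n; apply/polyP=> i; rewrite coef_Poly.
have [lt_i_n | le_n_i] := ltnP i n; first by rewrite nth_mkseq.
by rewrite !nth_default ?size_mkseq //; apply: leq_trans le_n_i.
Qed.

(** Turns a degree bound into equations on explicit coefficients. With [p = 0] and [n = 0] every
    entry of the list vanishes. *)
Lemma Poly_high_coef (R : nzSemiRingType) (p : {poly R}) (l : seq R) (n : nat) :
  p = Poly l -> (size p <= n)%N -> forall i, (n <= i)%N -> l`_i = 0.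
Proof.
by move=> -> le_p_n i le_n_i; rewrite -coef_Poly nth_default // (leq_trans le_p_n).
Qed.

(** The elimination tool: [z = 0] is an equation of the system, and [ring] exhibits it as
    [c * (x - y)], which determines the unknown [x]. *)
Lemma eq_by_scaling (R : idomainType) (c x y z : R) :
  c != 0 -> z = 0 -> c * (x - y) = z -> x = y.
Proof.
by move=> nz_c -> /eqP; rewrite mulf_eq0 (negPf nz_c) subr_eq0 => /eqP.
Qed.

(** * The triangular systems for M = 3 and M = 4 *)

(** The leading coefficient [r2] decides. If it is 0, the other unknowns of r, s and e vanish one
    after another. If not, it can be divided out, and everything becomes a monomial in one parameter
    u, of weight 2 under T -> aT. *)
Lemma depressed_solution3 (k : fieldType) (h r s : {poly k})
    (e := 3 * r ^+ 2 - 2 * s * h) :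
  2 != 0 :> k -> 3 != 0 :> k ->
  h \is monic -> size h = 4 -> h`_2 = 0 -> (size r <= 3)%N -> (size s <= 2)%N ->
  (size e <= 1)%N -> (size (h ^+ 2 * e - r ^+ 3)%R <= 5)%N ->
  (r = 0 /\ s = 0) \/
  exists2 u : k, u != 0 &
    [/\ h = Poly [:: 0; 4 * u; 0; 1], r = Poly [:: 24 * u ^+ 3; 0; 12 * u ^+ 2]
      & s = Poly [:: 0; 216 * u ^+ 4]].
Proof.
move=> nz2 nz3 mon_h sz_h hc_0 sz_r sz_s sz_e szD.
have lead_h: h`_3 = 1 by have := monicP mon_h; rewrite lead_coefE sz_h.
have := @Poly_mkseq_coef _ h 4; rewrite sz_h => /(_ isT) Eh.
have Er := Poly_mkseq_coef sz_r; have Es := Poly_mkseq_coef sz_s.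
have Ee := Poly_mkseq_coef sz_e.
rewrite /mkseq /= in Eh Er Es Ee; rewrite hc_0 lead_h in Eh.
have eqe: 3 * r ^+ 2 - 2 * s * h - e = 0 by rewrite /e; ring.
move: {hc_0 lead_h sz_r sz_s sz_e mon_h sz_h} (h`_0) (h`_1) Eh => h0 h1 Eh.
move: (r`_0) (r`_1) (r`_2) Er => r0 r1 r2 Er.
move: (s`_0) (s`_1) Es => s0 s1 Es.
(* From here e is only a constant [e0] tied to h, r, s by [eqe], so its small degree becomes a list
   of polynomial equations. *)
move: e (e`_0) Ee eqe szD => e e0 Ee eqe szD.
have eqe': 0 = Poly [::
    3 * r0 ^+ 2 - 2 * s0 * h0 - e0;
    6 * r0 * r1 - 2 * s0 * h1 - 2 * s1 * h0;
    3 * r1 ^+ 2 + 6 * r0 * r2 - 2 * s1 * h1;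
    6 * r1 * r2 - 2 * s0;
    3 * r2 ^+ 2 - 2 * s1].
  by rewrite -eqe Eh Er Es Ee /= !cons_poly_def; ring.
have sz0: (size (0%R : {poly k}) <= 0)%N by rewrite size_poly0.
have C := Poly_high_coef eqe' sz0.
move: (C 0%N isT) (C 1%N isT) (C 2%N isT) (C 3%N isT) (C 4%N isT).
move=> {C} /= C0 C1 C2 C3 C4.
have eqD: h ^+ 2 * e - r ^+ 3 = Poly [::
    h0 ^+ 2 * e0 - r0 ^+ 3;
    2 * h0 * h1 * e0 - 3 * r0 ^+ 2 * r1;
    h1 ^+ 2 * e0 - 3 * r0 ^+ 2 * r2 - 3 * r0 * r1 ^+ 2;
    2 * h0 * e0 - 6 * r0 * r1 * r2 - r1 ^+ 3;
    2 * h1 * e0 - 3 * r0 * r2 ^+ 2 - 3 * r1 ^+ 2 * r2;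
    - (3 * r1 * r2 ^+ 2);
    e0 - r2 ^+ 3].
  by rewrite Eh Er Ee /= !cons_poly_def; ring.
have {eqD szD} D := Poly_high_coef eqD szD.
move: (D 5%N isT) (D 6%N isT) => {D} /= D5 /subr0_eq D6.
have nz4: 4 != 0 :> k by rewrite (_ : 4 = 2 * 2) ?mulf_neq0 //; ring.
have nz6: 6 != 0 :> k by rewrite (_ : 6 = 2 * 3) ?mulf_neq0 //; ring.
have [r2_0 | nz_r2] := eqVneq r2 0.
  left.
  have e0_0: e0 = 0 by rewrite D6 r2_0 expr0n.
  have s1_0: s1 = 0.
    by apply: (eq_by_scaling (c := -2) _ C4); rewrite ?oppr_eq0 // r2_0; ring.
  have s0_0: s0 = 0.
    by apply: (eq_by_scaling (c := -2) _ C3); rewrite ?oppr_eq0 // r2_0; ring.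
  have r1_0: r1 = 0.
    apply/eqP; rewrite -sqrf_eq0; apply/eqP.
    by apply: (eq_by_scaling nz3 C2); rewrite r2_0 s1_0; ring.
  have r0_0: r0 = 0.
    apply/eqP; rewrite -sqrf_eq0; apply/eqP.
    by apply: (eq_by_scaling nz3 C0); rewrite s0_0 e0_0; ring.
  by rewrite Er Es r0_0 r1_0 r2_0 s0_0 s1_0 /= !cons_poly_def !(polyC0, mul0r, addr0).
right.
have r1_0: r1 = 0.
  by apply: (eq_by_scaling (c := - (3 * r2 ^+ 2)) _ D5);
    [rewrite oppr_eq0 mulf_neq0 ?expf_neq0 | ring].
have s0_0: s0 = 0.
  by apply: (eq_by_scaling (c := -2) _ C3); rewrite ?oppr_eq0 // r1_0; ring.
(* Subtracting [h0] times [C4] from [C1] eliminates [s1]; the same is done below with [h1] and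
   [C2]. *)
have h0_0: h0 = 0.
  apply: (eq_by_scaling (c := - (3 * r2 ^+ 2)) 
    (z := 6 * r0 * r1 - 2 * s0 * h1 - 2 * s1 * h0 - h0 * (3 * r2 ^+ 2 - 2 * s1))).
  - by rewrite oppr_eq0 mulf_neq0 ?expf_neq0.
  - by rewrite C1 C4 mulr0 subr0.
  by rewrite r1_0 s0_0; ring.
(* The factor 4 only keeps the coefficients of the solution integral. *)
have [u def_h1]: exists u, h1 = 4 * u by exists (h1 / 4); rewrite mulrC divfK.
have def_r0: r0 = 2 * u * r2.
  apply: (eq_by_scaling (c := 6 * r2) 
    (z := 3 * r1 ^+ 2 + 6 * r0 * r2 - 2 * s1 * h1 - h1 * (3 * r2 ^+ 2 - 2 * s1))).
  - by rewrite mulf_neq0.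
  - by rewrite C2 C4 mulr0 subr0.
  by rewrite r1_0 def_h1; ring.
have def_r2: r2 = 12 * u ^+ 2.
  apply: (eq_by_scaling (c := - r2 ^+ 2) _ C0); first by rewrite oppr_eq0 expf_neq0.
  by rewrite D6 def_r0 s0_0; ring.
have def_s1: s1 = 216 * u ^+ 4.
  by apply: (eq_by_scaling (c := -2) _ C4); rewrite ?oppr_eq0 // def_r2; ring.
exists u.
  by apply: contraNneq nz_r2 => u_0; rewrite def_r2 u_0 expr0n mulr0.
rewrite Eh Er Es h0_0 def_h1 def_r0 r1_0 def_r2 s0_0 def_s1; split=> //.
by congr (Poly [:: _; _; _]); ring.
Qed.

(** The same elimination, now governed by [r3]. The surviving parameter is a = [r2 / r3], of weight
    1 under T -> aT. *)
Lemma depressed_solution4 (k : fieldType) (h r s : {poly k})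
    (e := 3 * r ^+ 2 - 2 * s * h) :
  2 != 0 :> k -> 3 != 0 :> k ->
  h \is monic -> size h = 5 -> h`_3 = 0 -> (size r <= 4)%N -> (size s <= 3)%N ->
  (size e <= 2)%N -> (size (h ^+ 2 * e - r ^+ 3)%R <= 6)%N ->
  (r = 0 /\ s = 0) \/
  exists2 a : k, a != 0 &
    [/\ h = Poly [:: 301 * a ^+ 4; - (88 * a ^+ 3); 42 * a ^+ 2; 0; 1],
        r = (- (3072 * a ^+ 5)) *:
             Poly [:: - (29 * a ^+ 3); 27 * a ^+ 2; a; 1]
      & s = (54 * 2 ^+ 18 * a ^+ 10) *: Poly [:: 13 * a ^+ 2; 2 * a; 1]].
Proof.
move=> nz2 nz3 mon_h sz_h hc_0 sz_r sz_s sz_e szD.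
have lead_h: h`_4 = 1 by have := monicP mon_h; rewrite lead_coefE sz_h.
have := @Poly_mkseq_coef _ h 5; rewrite sz_h => /(_ isT) Eh.
have Er := Poly_mkseq_coef sz_r; have Es := Poly_mkseq_coef sz_s.
have Ee := Poly_mkseq_coef sz_e.
rewrite /mkseq /= in Eh Er Es Ee; rewrite hc_0 lead_h in Eh.
have eqe: 3 * r ^+ 2 - 2 * s * h - e = 0 by rewrite /e; ring.
move: {hc_0 lead_h sz_r sz_s sz_e mon_h sz_h} (h`_0) (h`_1) (h`_2) Eh => h0 h1 h2 Eh.
move: (r`_0) (r`_1) (r`_2) (r`_3) Er => r0 r1 r2 r3 Er.
move: (s`_0) (s`_1) (s`_2) Es => s0 s1 s2 Es.
move: e (e`_0) (e`_1) Ee eqe szD => e e0 e1 Ee eqe szD.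
have eqe': 0 = Poly [::
    3 * r0 ^+ 2 - 2 * s0 * h0 - e0;
    6 * r0 * r1 - 2 * s0 * h1 - 2 * s1 * h0 - e1;
    3 * r1 ^+ 2 + 6 * r0 * r2 - 2 * s0 * h2 - 2 * s1 * h1 - 2 * s2 * h0;
    6 * r1 * r2 + 6 * r0 * r3 - 2 * s1 * h2 - 2 * s2 * h1;
    3 * r2 ^+ 2 + 6 * r1 * r3 - 2 * s2 * h2 - 2 * s0;
    6 * r2 * r3 - 2 * s1;
    3 * r3 ^+ 2 - 2 * s2].
  by rewrite -eqe Eh Er Es Ee /= !cons_poly_def; ring.
have eqD: h ^+ 2 * e - r ^+ 3 = Poly [::
    h0 ^+ 2 * e0 - r0 ^+ 3;
    2 * h0 * h1 * e0 + h0 ^+ 2 * e1 - 3 * r0 ^+ 2 * r1;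
    (2 * h0 * h2 + h1 ^+ 2) * e0 + 2 * h0 * h1 * e1 - 3 * r0 ^+ 2 * r2 - 3 * r0 * r1 ^+ 2;
    2 * h1 * h2 * e0 + (2 * h0 * h2 + h1 ^+ 2) * e1 
      - 3 * r0 ^+ 2 * r3 - 6 * r0 * r1 * r2 - r1 ^+ 3;
    (h2 ^+ 2 + 2 * h0) * e0 + 2 * h1 * h2 * e1 
      - 6 * r0 * r1 * r3 - 3 * r0 * r2 ^+ 2 - 3 * r1 ^+ 2 * r2;
    2 * h1 * e0 + (h2 ^+ 2 + 2 * h0) * e1
      - 6 * r0 * r2 * r3 - 3 * r1 ^+ 2 * r3 - 3 * r1 * r2 ^+ 2;
    2 * h2 * e0 + 2 * h1 * e1 - 3 * r3 ^+ 2 * r0 - 6 * r3 * r2 * r1 - r2 ^+ 3;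
    2 * h2 * e1 - 3 * r3 ^+ 2 * r1 - 3 * r3 * r2 ^+ 2;
    e0 - 3 * r3 ^+ 2 * r2;
    e1 - r3 ^+ 3].
  by rewrite Eh Er Ee /= !cons_poly_def; ring.
have sz0: (size (0%R : {poly k}) <= 0)%N by rewrite size_poly0.
have {eqe'} C := Poly_high_coef eqe' sz0.
move: (C 0%N isT) (C 1%N isT) (C 2%N isT) (C 3%N isT) => /= C0 C1 C2 C3.
move: (C 4%N isT) (C 5%N isT) (C 6%N isT) => {C} /= C4 C5 C6.
have {eqD szD} D := Poly_high_coef eqD szD.
move: (D 6%N isT) (D 7%N isT) (D 8%N isT) (D 9%N isT).
move=> {D} /= D6 D7 /subr0_eq D8 /subr0_eq D9.
have nz6: 6 != 0 :> k by rewrite (_ : 6 = 2 * 3) ?mulf_neq0 //; ring.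
have [r3_0 | nz_r3] := eqVneq r3 0.
  left.
  have e1_0: e1 = 0 by rewrite D9 r3_0 expr0n.
  have e0_0: e0 = 0 by rewrite D8 r3_0 expr0n mulr0 mul0r.
  have r2_0: r2 = 0.
    apply/eqP; suff: r2 ^+ 3 == 0 by rewrite expf_eq0.
    apply/eqP.
    apply: (eq_by_scaling (c := -1) _ D6); rewrite ?oppr_eq0 ?oner_eq0 //.
    by rewrite r3_0 e1_0 e0_0; ring.
  have s2_0: s2 = 0.
    by apply: (eq_by_scaling (c := -2) _ C6); rewrite ?oppr_eq0 // r3_0; ring.
  have s1_0: s1 = 0.
    by apply: (eq_by_scaling (c := -2) _ C5); rewrite ?oppr_eq0 // r3_0; ring.
  have s0_0: s0 = 0.
    apply: (eq_by_scaling (c := -2) _ C4); rewrite ?oppr_eq0 //.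
    by rewrite r3_0 r2_0 s2_0; ring.
  have r1_0: r1 = 0.
    apply/eqP; rewrite -sqrf_eq0; apply/eqP.
    by apply: (eq_by_scaling nz3 C2); rewrite r2_0 s2_0 s1_0 s0_0; ring.
  have r0_0: r0 = 0.
    apply/eqP; rewrite -sqrf_eq0; apply/eqP.
    by apply: (eq_by_scaling nz3 C0); rewrite s0_0 e0_0; ring.
  rewrite Er Es r0_0 r1_0 r2_0 r3_0 s0_0 s1_0 s2_0 /=.
  by rewrite !cons_poly_def !(polyC0, mul0r, addr0).
right.
have [w def_r3]: exists w, r3 = 6 * w by exists (r3 / 6); rewrite mulrC divfK.
have nz_w: w != 0 by apply: contraNneq nz_r3 => w_0; rewrite def_r3 w_0 mulr0.
(* From here on r = 6w(T^3 + aT^2 + (a^2 + 2v)T + c); the remaining equations give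
   h2, h1, h0, c and w in terms of a and v, and finally v. *)
have [a def_r2]: exists a, r2 = 6 * w * a.
  by exists (r2 / r3); rewrite -def_r3 mulrC divfK.
have [c def_r0]: exists c, r0 = 6 * w * c.
  by exists (r0 / r3); rewrite -def_r3 mulrC divfK.
(* This choice of v leaves [h2] and [s0] without denominators: they become 3(a^2 + v) and 54 w^2
   v. *)
have [v def_r1]: exists v, r1 = 6 * w * (a ^+ 2 + 2 * v).
  exists ((r1 / r3 - a ^+ 2) / 2); rewrite -def_r3.
  by rewrite [2 * _]mulrC divfK // addrC subrK mulrC divfK.
subst r3 r2 r1 r0.
have def_e1: e1 = 216 * w ^+ 3 by rewrite D9; ring.
have def_e0: e0 = 648 * w ^+ 3 * a by rewrite D8; ring.
have def_s2: s2 = 54 * w ^+ 2.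
  by apply: (eq_by_scaling (c := -2) _ C6); rewrite ?oppr_eq0 //; ring.
have def_s1: s1 = 108 * w ^+ 2 * a.
  by apply: (eq_by_scaling (c := -2) _ C5); rewrite ?oppr_eq0 //; ring.
have nz108: 108 != 0 :> k.
  by rewrite (_ : 108 = 3 * 6 ^+ 2) ?mulf_neq0 ?expf_neq0 //; ring.
have nz216: 216 != 0 :> k by rewrite (_ : 216 = 6 ^+ 3) ?expf_neq0 //; ring.
have nz_w2: 108 * w ^+ 2 != 0 by rewrite mulf_neq0 ?expf_neq0.
have nz_w3: 216 * w ^+ 3 != 0 by rewrite mulf_neq0 ?expf_neq0.
subst e1 e0 s2 s1.
have def_h2: h2 = 3 * (a ^+ 2 + v) 
  by apply: (eq_by_scaling (mulf_neq0 nz2 nz_w3) D7); ring.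
subst h2.
have def_s0: s0 = 54 * w ^+ 2 * v.
  by apply: (eq_by_scaling (c := -2) _ C4); rewrite ?oppr_eq0 //; ring.
subst s0.
have def_h1: h1 = 2 * c - 4 * a ^+ 3 - 2 * a * v.
  by apply: (eq_by_scaling (c := - (108 * w ^+ 2)) _ C3); rewrite ?oppr_eq0 //; ring.
subst h1.
have def_c: c = - 3 * a ^+ 3 - 2 * a * v.
  by apply: (eq_by_scaling nz_w3 D6); ring.
subst c.
have def_h0: h0 = 15 * a ^+ 4 + 9 * a ^+ 2 * v + v ^+ 2.
  by apply: (eq_by_scaling (c := - (108 * w ^+ 2)) _ C2); rewrite ?oppr_eq0 //; ring.
subst h0.
(* In [C1] every term has a factor w^2 and only [e1] has w^3, so after division by w^2 the equation
   is linear in w. *)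
have def_w: w = - 2 * a * (3 * a ^+ 2 + v) ^+ 2.
  by apply: (eq_by_scaling (c := - (216 * w ^+ 2)) _ C1);
    [rewrite oppr_eq0 mulf_neq0 ?expf_neq0 | ring].
have nz_a: a != 0.
  by apply: contraNneq nz_w => a_0; rewrite def_w a_0 mulr0 mul0r.
have nz_p: 3 * a ^+ 2 + v != 0.
  by apply: contraNneq nz_w => p_0; rewrite def_w p_0 expr0n mulr0.
(* Substituting everything in C0, the left-hand side becomes 108 w^2 times
   (3 a^2 + v)^2 (13 a^2 - v), and w <> 0 excludes the first factor. *)
have def_v: v = 13 * a ^+ 2.
  have Cw := congr1 (fun x => 648 * w ^+ 2 * a * (w - x)) def_w.
  rewrite /= subrr mulr0 in Cw.
  have /= Cz := congr2 +%R C0 (esym Cw); rewrite addr0 in Cz.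
  apply: (eq_by_scaling (c := - (108 * w ^+ 2 * (3 * a ^+ 2 + v) ^+ 2)) _ Cz).
    by rewrite oppr_eq0 mulf_neq0 ?expf_neq0.
  by ring.
exists a => //; rewrite Eh Er Es def_w def_v.
split.
- congr (Poly [:: _; _; _; _; _]); ring.
- rewrite /= !cons_poly_def -!mul_polyC; ring.
- rewrite /= !cons_poly_def -!mul_polyC; ring.
Qed.

(** * Polynomial square roots and the parametrization of (f, g) *)

(** The expansion of the square root of p at infinity, one coefficient per step. Adding cT^m with m
    < n changes h^2 by 2c h T^m + c^2 T^(2m), which has coefficient 2c at T^(n+m) and nothing above;
    as 2 is invertible, c can clear the top coefficient of p - h^2. *)
Lemma monic_sqrt_approx (k : fieldType) (p : {poly k}) (n j : nat) :
  2 != 0 :> k -> p \is monic -> size p = (2 * n).+1 -> (j <= n)%N ->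
  exists h : {poly k},
    [/\ h \is monic, size h = n.+1 & (size (p - h ^+ 2)%R <= 2 * n - j)%N].
Proof.
move=> nz2 mon_p sz_p; elim: j => [_ | j IHj lt_j_n].
  exists 'X^n; rewrite monicXn size_polyXn; split=> //.
  rewrite subn0; apply/leq_sizeP=> i le_i; rewrite coefB -exprM coefXn.
  have [-> | ne_i] := eqVneq i (n * 2)%N.
    have := monicP mon_p; rewrite lead_coefE sz_p mulnC => ->; exact: subrr.
  rewrite subr0 nth_default // sz_p; lia.
have [h [mon_h sz_h /leq_sizeP sz_ph]] := IHj (ltnW lt_j_n).
pose m := (n - j.+1)%N.
pose c := (p - h ^+ 2)`_(n + m) / 2.
have sz_c: (size (c%:P * 'X^m)%R < size h)%N.
  rewrite sz_h mul_polyC; apply: leq_ltn_trans (size_scale_leq _ _) _.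
  by rewrite size_polyXn /m; lia.
exists (h + c%:P * 'X^m); split.
- by rewrite monicE lead_coefDl // -monicE.
- by rewrite size_polyDl.
apply/leq_sizeP=> i le_i.
have ->: p - (h + c%:P * 'X^m) ^+ 2
       = p - h ^+ 2 - (2 * c)%:P * (h * 'X^m) - (c ^+ 2)%:P * ('X^m * 'X^m) by ring.
rewrite -exprD 2!coefB !coefCM coefMXn coefXn.
have [-> | ne_i] := eqVneq i (n + m)%N.
  rewrite ltnNge leq_addl /= addnK.
  have := monicP mon_h; rewrite lead_coefE sz_h /= => ->.
  rewrite [(_ + _ == _)%N]gtn_eqF ?mulr0 ?subr0 ?mulr1; last by rewrite /m; lia.
  by rewrite mulrC divfK // subrr.
rewrite sz_ph; last by rewrite /m in ne_i *; lia.
rewrite [h`__]nth_default; last by rewrite sz_h /m in ne_i *; lia.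
rewrite gtn_eqF; last by rewrite /m; lia.
by rewrite if_same !mulr0 !subr0.
Qed.

(** The remainder is written 2r so that h^3 + 3rh, the start of the expansion of p^(3/2), has no
    denominators. *)
Lemma monic_sqrt (k : fieldType) (p : {poly k}) (n : nat) :
  2 != 0 :> k -> p \is monic -> size p = (2 * n).+1 ->
  exists h r : {poly k},
    [/\ h \is monic, size h = n.+1, (size r <= n)%N & p = h ^+ 2 + 2 * r].
Proof.
move=> nz2 mon_p sz_p.
have [h [mon_h sz_h sz_r]] := monic_sqrt_approx nz2 mon_p sz_p (leqnn n).
exists h, (2^-1 *: (p - h ^+ 2)); split=> //.
  by rewrite (leq_trans (size_scale_leq _ _)) // (leq_trans sz_r) //; lia.
rewrite -mul_polyC mulrA [2 * _](_ : _ = (2 * 2^-1)%:P); last by ring.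
by rewrite mulfV // mul1r addrC subrK.
Qed.

(** The grouping sets apart 3re - s^2, which has degree at most M + 1 once s and e are known to be
    small, so that only h^2 e - r^3 carries conditions. *)
Lemma cube_sub_square (R : comNzRingType) (h r s : R) :
  (h ^+ 2 + 2 * r) ^+ 3 - (h ^+ 3 + 3 * r * h + s) ^+ 2
  = h ^+ 2 * (3 * r ^+ 2 - 2 * s * h) - r ^+ 3
    + (3 * r * (3 * r ^+ 2 - 2 * s * h) - s ^+ 2).
Proof. ring. Qed.

Lemma size_polyD_leq (R : nzSemiRingType) (p q : {poly R}) (n : nat) :
  (size p <= n)%N -> (size q <= n)%N -> (size (p + q)%R <= n)%N.
Proof. by move=> szp szq; rewrite (leq_trans (size_polyD _ _)) // geq_max szp. Qed.

Lemma size_polyB_leq (R : nzRingType) (p q : {poly R}) (n : nat) :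
  (size p <= n)%N -> (size q <= n)%N -> (size (p - q)%R <= n)%N.
Proof. by move=> szp szq; rewrite size_polyD_leq ?size_polyN. Qed.

Lemma size_natr_mul_leq (R : nzSemiRingType) (p : {poly R}) (m n : nat) :
  (size p <= n)%N -> (size (m%:R * p)%R <= n)%N.
Proof.
by rewrite mulr_natl -scaler_nat => szp; rewrite (leq_trans (size_scale_leq _ _)).
Qed.

Lemma size_leq_mulr (R : idomainType) (p q : {poly R}) (m n : nat) :
  size q = n.+1 -> (size (p * q)%R <= n + m)%N -> (size p <= m)%N.
Proof.
move=> sz_q; have [-> | nz_p] := eqVneq p 0; first by rewrite size_poly0.
have nz_q: q != 0 by rewrite -size_poly_eq0 sz_q.
by rewrite size_mul // sz_q addnS addnC leq_add2l.
Qed.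

(** With h and r from the square root of f, s is what g adds to h^3 + 3rh. The bounds on s and then
    on e come from writing s and e times a polynomial of known degree in terms of f^3 - g^2 and
    small terms. *)
Lemma decomposition (k : fieldType) (M : nat) (f g : {poly k}) :
  2 != 0 :> k -> (2 < M <= 5)%N -> f \is monic -> g \is monic ->
  has_deg f (2 * M) -> has_deg g (3 * M) -> (size (f ^+ 3 - g ^+ 2)%R <= M.+2)%N ->
  exists h r s : {poly k},
    [/\ [/\ h \is monic, size h = M.+1, (size r <= M)%N & (size s <= M.-1)%N],
        f = h ^+ 2 + 2 * r, g = h ^+ 3 + 3 * r * h + s,
        (size (3 * r ^+ 2 - 2 * s * h)%R <= M - 2)%N
      & (size (h ^+ 2 * (3 * r ^+ 2 - 2 * s * h) - r ^+ 3)%R <= M.+2)%N].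
Proof.
move=> nz2 /andP[M3 M5] mon_f mon_g sz_f sz_g sz_D.
have [h [r [mon_h sz_h sz_r def_f]]] := monic_sqrt nz2 mon_f sz_f.
pose s := g - h ^+ 3 - 3 * r * h.
have def_g: g = h ^+ 3 + 3 * r * h + s by rewrite /s; ring.
pose e := 3 * r ^+ 2 - 2 * s * h.
have sz_mul (p q : {poly k}) m n l : (size p <= m)%N -> (size q <= n)%N ->
    (0 < m)%N -> (0 < n)%N -> (m + n <= l.+1)%N -> (size (p * q)%R <= l)%N.
  by move=> szp szq *; rewrite (leq_trans (size_polyMleq _ _)) //; lia.
have nz_h: h != 0 by rewrite monic_neq0.
have mon_h2 : h ^+ 2 \is monic by rewrite monic_exp.
have mon_h3 : h ^+ 3 \is monic by rewrite monic_exp.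
have sz_h2: size (h ^+ 2) = (2 * M).+1.
  by rewrite expr2 size_Mmonic // sz_h; lia.
have sz_h3: size (h ^+ 3) = (3 * M).+1.
  by rewrite exprSr size_Mmonic ?monic_neq0 // sz_h sz_h2; lia.
have sz_rh l : (2 * M <= l)%N -> (size (3 * r * h)%R <= l)%N.
  move=> le_l; rewrite -mulrA; apply: size_natr_mul_leq.
  by apply: (@sz_mul _ _ M M.+1); rewrite ?sz_h //; lia.
have sz_r2 l : (2 * M <= l.+1)%N -> (size (r ^+ 2)%R <= l)%N.
  by move=> le_l; rewrite expr2; apply: (@sz_mul _ _ M M) => //; lia.
have sz_r3 l : (3 * M <= l.+2)%N -> (size (r ^+ 3)%R <= l)%N.
  move=> le_l; rewrite exprSr; apply: (@sz_mul _ _ (2 * M).-1 M) => //; try lia.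
  by apply: sz_r2; lia.
(* As g and h^3 are both monic of degree 3M, s has smaller degree. This gives t below the leading
   term 2T^(3M). *)
have sz_s0: (size s <= 3 * M)%N.
  apply/leq_sizeP=> i le_i; rewrite /s !coefB.
  rewrite [(3 * r * h)`_i]nth_default ?subr0; last first.
    by rewrite (leq_trans _ le_i) // sz_rh //; lia.
  have [lt_i | ge_i] := ltnP (3 * M) i.
    by rewrite !nth_default ?subr0 ?sz_h3 ?sz_g.
  have -> : i = (3 * M)%N by apply/eqP; rewrite eqn_leq ge_i.
  have := monicP mon_g; rewrite lead_coefE sz_g /= => ->.
  have := monicP mon_h3; rewrite lead_coefE sz_h3 /= => ->.
  exact: subrr.
have sz_s: (size s <= M.-1)%N.
  (* Here t = g + (h^3 + 3rh), so s t is the difference of squares g^2 - (h^3 + 3rh)^2, and f^3 -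
     (h^3 + 3rh)^2 is just 3h^2 r^2 + 8r^3. *)
  pose t := 2 * h ^+ 3 + 2 * (3 * r * h) + s.
  have sz_t: size t = (3 * M).+1.
    have sz_2h: size (2 * h ^+ 3) = (3 * M).+1.
      by rewrite mulr_natl -scaler_nat size_scale.
    rewrite /t -addrA size_polyDl sz_2h // ltnS size_polyD_leq //.
    by rewrite size_natr_mul_leq ?sz_rh //; lia.
  have Est: s * t = 3 * (h ^+ 2 * r ^+ 2) + 8 * r ^+ 3 - (f ^+ 3 - g ^+ 2).
    by rewrite def_f def_g /t; ring.
  apply: size_leq_mulr sz_t _.
  rewrite Est; apply: size_polyB_leq; last by apply: leq_trans sz_D _; lia.
  apply: size_polyD_leq; apply: size_natr_mul_leq; last by apply: sz_r3; lia.
  by apply: (@sz_mul _ _ (2 * M).+1 (2 * M).-1); rewrite ?sz_h2 ?sz_r2 //; lia.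
have sz_s2 l : (2 * M.-1 <= l.+1)%N -> (size (s ^+ 2)%R <= l)%N.
  by move=> le_l; rewrite expr2; apply: (@sz_mul _ _ M.-1 M.-1) => //; lia.
have sz_e: (size e <= M - 2)%N.
  (* In [cube_sub_square] the two terms containing e combine to e(h^2 + 3r). *)
  pose t := h ^+ 2 + 3 * r.
  have sz_t: size t = (2 * M).+1.
    by rewrite /t size_polyDl sz_h2 // ltnS size_natr_mul_leq // (leq_trans sz_r) //; lia.
  have Eet: e * t = (f ^+ 3 - g ^+ 2) + (r ^+ 3 + s ^+ 2).
    by rewrite def_f def_g /t /e; ring.
  apply: size_leq_mulr sz_t _.
  rewrite Eet; apply: size_polyD_leq; first by apply: leq_trans sz_D _; lia.
  by apply: size_polyD_leq; [apply: sz_r3 | apply: sz_s2]; lia.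
exists h, r, s; split=> //.
have ->: h ^+ 2 * (3 * r ^+ 2 - 2 * s * h) - r ^+ 3
       = (f ^+ 3 - g ^+ 2) - (3 * (r * e) - s ^+ 2).
  by rewrite def_f def_g cube_sub_square /e; ring.
(* Both re and s^2 have size at most 2M - 3, which is at most M + 2 because M <= 5. *)
apply: size_polyB_leq => //; apply: size_polyB_leq; last by apply: sz_s2; lia.
by apply: size_natr_mul_leq; apply: (@sz_mul _ _ M (M - 2)%N) => //; lia.
Qed.

(** * The parametrized pairs and the affine and scaling equivalence *)

Definition cube_square_pair (k : fieldType) (h r s : {poly k}) :=
  (h ^+ 2 + 2 * r, h ^+ 3 + 3 * r * h + s).

(* These are the solutions u = 1 and a = 1 of [depressed_solution3] and
   [depressed_solution4]. *)
Definition extremal3 (k : fieldType) : {poly k} * {poly k} :=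
  cube_square_pair (Poly [:: 0; 4; 0; 1]) (Poly [:: 24; 0; 12]) (Poly [:: 0; 216]).

Definition extremal4 (k : fieldType) : {poly k} * {poly k} :=
  cube_square_pair (Poly [:: 301; - 88; 42; 0; 1])
    (- 3072 * Poly [:: - 29; 27; 1; 1]) (54 * 2 ^+ 18 * Poly [:: 13; 2; 1]).

Lemma size_linear (k : fieldType) (a b : k) :
  a != 0 -> size (a *: 'X + b%:P) = 2%N.
Proof.
move=> nz_a; rewrite -mul_polyC size_MXaddC polyC_eq0 (negPf nz_a).
by rewrite size_polyC nz_a.
Qed.

Lemma affine_scaling_sym (k : fieldType) (fg fg' : {poly k} * {poly k}) :
  affine_scaling_equiv fg fg' -> affine_scaling_equiv fg' fg.
Proof.
case=> a [b [c [nz_a nz_c E1 E2]]].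
exists a^-1, (- (b / a)), c^-1; rewrite !invr_eq0 nz_a nz_c.
have lin: (a *: 'X + b%:P) \Po (a^-1 *: 'X + (- (b / a))%:P) = 'X.
  rewrite comp_polyD comp_polyZ comp_polyX comp_polyC scalerDr scalerA mulfV //.
  by rewrite scale1r -mul_polyC -polyCM mulrN mulrC divfK // polyCN subrK.
by rewrite E1 E2; split; rewrite // comp_polyZ -comp_polyA lin comp_polyXr scalerA
  -exprMn mulVf // expr1n scale1r.
Qed.

Lemma affine_scaling_trans (k : fieldType) (fg1 fg2 fg3 : {poly k} * {poly k}) :
  affine_scaling_equiv fg1 fg2 -> affine_scaling_equiv fg2 fg3 ->
  affine_scaling_equiv fg1 fg3.
Proof.
case=> a [b [c [nz_a nz_c E1 E2]]] [a' [b' [c' [nz_a' nz_c' E1' E2']]]].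
exists (a * a'), (a * b' + b), (c' * c); rewrite !mulf_neq0 // E1' E2' E1 E2.
have lin: (a *: 'X + b%:P) \Po (a' *: 'X + b'%:P) = (a * a') *: 'X + (a * b' + b)%:P.
  rewrite comp_polyD comp_polyZ comp_polyX comp_polyC scalerDr scalerA.
  by rewrite -[a *: b'%:P]mul_polyC -polyCM -addrA -polyCD.
by split; rewrite // comp_polyZ -comp_polyA lin scalerA -exprMn.
Qed.

(** The scaling multiplies f^3 - g^2 by c^6, and composition with a linear polynomial keeps the
    degree. *)
Lemma size_diff_affine_scaling (k : fieldType) (fg fg' : {poly k} * {poly k}) :
  affine_scaling_equiv fg fg' ->
  size (fg'.1 ^+ 3 - fg'.2 ^+ 2) = size (fg.1 ^+ 3 - fg.2 ^+ 2).
Proof.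
case=> a [b [c [nz_a nz_c -> ->]]].
have ->: (c ^+ 2 *: (fg.1 \Po (a *: 'X + b%:P))) ^+ 3
         - (c ^+ 3 *: (fg.2 \Po (a *: 'X + b%:P))) ^+ 2
       = c ^+ 6 *: ((fg.1 ^+ 3 - fg.2 ^+ 2) \Po (a *: 'X + b%:P)).
  by rewrite -!mul_polyC; ring.
by rewrite size_scale ?expf_neq0 // size_comp_poly2 // size_linear.
Qed.

(** Let A and B be the leading coefficients. The drop in degree forces A^3 = B^2, so c = A/B gives
    c^2 A = c^3 B = A^3/B^2 = 1, without extracting a root. *)
Lemma monic_normalization (k : fieldType) (M : nat) (f g : {poly k}) :
  has_deg f (2 * M) -> has_deg g (3 * M) -> (size (f ^+ 3 - g ^+ 2)%R <= 6 * M)%N ->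
  exists F G : {poly k},
    [/\ F \is monic, G \is monic, has_deg F (2 * M), has_deg G (3 * M)
      & affine_scaling_equiv (f, g) (F, G)].
Proof.
move=> sz_f sz_g sz_D.
set A := lead_coef f; set B := lead_coef g.
have nz_A: A != 0 by rewrite lead_coef_eq0 -size_poly_eq0 sz_f.
have nz_B: B != 0 by rewrite lead_coef_eq0 -size_poly_eq0 sz_g.
have szX (p : {poly k}) i n : has_deg p n -> (p ^+ i)`_(n * i) = lead_coef p ^+ i.
  move=> sz_p; have nz_p: p != 0 by rewrite -size_poly_eq0 sz_p.
  rewrite -lead_coef_exp lead_coefE; congr (_ `_ _).
  by rewrite size_exp sz_p.
have EAB: A ^+ 3 = B ^+ 2.
  apply/eqP; rewrite -subr_eq0 -(szX _ _ _ sz_f) -(szX _ _ _ sz_g).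
  by rewrite mulnAC [in X in _ - X]mulnAC -coefB nth_default.
have nz_c: A / B != 0 by rewrite mulf_neq0 ?invr_eq0.
exists ((A / B) ^+ 2 *: f), ((A / B) ^+ 3 *: g); split.
- rewrite monicE lead_coefZ -/A expr_div_n -EAB; apply/eqP; field.
  by rewrite nz_A.
- rewrite monicE lead_coefZ -/B expr_div_n EAB; apply/eqP; field.
  by rewrite nz_B.
- by rewrite /has_deg size_scale // expf_neq0.
- by rewrite /has_deg size_scale // expf_neq0.
exists 1, 0, (A / B); rewrite oner_eq0 nz_c /= scale1r addr0 !comp_polyXr.
by split.
Qed.

(** When h, r, s have weights 1, 2, 3, the two components are homogeneous of weights 2 and 3, so the
    scaling by c = a^(-n) absorbs the powers of a^n. *)
Lemma cube_square_pair_equiv (k : fieldType) (h r s h' r' s' : {poly k})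
    (a b : k) (n : nat) :
  a != 0 -> h \Po (a *: 'X + b%:P) = a ^+ n *: h' ->
  r \Po (a *: 'X + b%:P) = (a ^+ n) ^+ 2 *: r' ->
  s \Po (a *: 'X + b%:P) = (a ^+ n) ^+ 3 *: s' ->
  affine_scaling_equiv (cube_square_pair h r s) (cube_square_pair h' r' s').
Proof.
move=> nz_a Eh Er Es; exists a, b, (a ^+ n)^-1.
have nz_an: a ^+ n != 0 by rewrite expf_neq0.
rewrite invr_eq0; split=> //=.
  have ->: (h ^+ 2 + 2 * r) \Po (a *: 'X + b%:P)
         = (a ^+ n) ^+ 2 *: (h' ^+ 2 + 2 * r').
    rewrite comp_polyD !rmorphXn !rmorphM /= rmorph_nat Eh Er -!mul_polyC; ring.
  by rewrite scalerA -exprMn mulVf // expr1n scale1r.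
have ->: (h ^+ 3 + 3 * r * h + s) \Po (a *: 'X + b%:P)
       = (a ^+ n) ^+ 3 *: (h' ^+ 3 + 3 * r' * h' + s').
  rewrite !comp_polyD !rmorphXn !rmorphM /= rmorph_nat Eh Er Es -!mul_polyC; ring.
by rewrite scalerA -exprMn mulVf // expr1n scale1r.
Qed.

Lemma cube_square_pair_deg (k : fieldType) (M : nat) (h r s : {poly k}) :
  (0 < M)%N -> size h = M.+1 -> (size r <= M)%N -> (size s <= M)%N ->
  has_deg (cube_square_pair h r s).1 (2 * M) /\
  has_deg (cube_square_pair h r s).2 (3 * M).
Proof.
move=> M_gt0 sz_h sz_r sz_s; have nz_h: h != 0 by rewrite -size_poly_eq0 sz_h.
have sz_hX n : size (h ^+ n) = (n * M).+1.
  have := size_exp h n; rewrite sz_h /= mulnC => <-.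
  by rewrite prednK // size_poly_gt0 expf_neq0.
have sz_rh: (size (r * h)%R <= 2 * M)%N.
  by rewrite (leq_trans (size_polyMleq _ _)) // sz_h; lia.
rewrite /has_deg /=; split.
  by rewrite size_polyDl sz_hX // ltnS size_natr_mul_leq // (leq_trans sz_r) //; lia.
rewrite -addrA size_polyDl sz_hX // ltnS -mulrA size_polyD_leq //.
  by rewrite size_natr_mul_leq // (leq_trans sz_rh) //; lia.
by rewrite (leq_trans sz_s) //; lia.
Qed.

(** * The model pairs reach degree M + 1 *)

(** Expansion gives f^3 - g^2 = 2^6 3^3 (2T^4 + 13T^2 + 64), whose leading coefficient has no prime
    factor besides 2 and 3. *)
Lemma extremal3P (k : fieldType) :
  2 != 0 :> k -> 3 != 0 :> k -> extremal_pair 3 (extremal3 k).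
Proof.
move=> nz2 nz3; rewrite /extremal3.
have [||||sz_f sz_g] := @cube_square_pair_deg k 3 (Poly [:: 0; 4; 0; 1])
  (Poly [:: 24; 0; 12]) (Poly [:: 0; 216]) => //.
- by rewrite (@PolyK _ 1) //= oner_eq0.
- exact: size_Poly.
- exact: leq_trans (size_Poly _) _.
split=> //; rewrite /has_deg.
pose c : k := 2 ^+ 6 * 3 ^+ 3.
have nz_c: c != 0 by rewrite mulf_neq0 ?expf_neq0.
have ->: (extremal3 k).1 ^+ 3 - (extremal3 k).2 ^+ 2
       = Poly [:: c * 64; 0; c * 13; 0; c * 2].
  by rewrite /extremal3 /cube_square_pair /c /= !cons_poly_def; ring.
by rewrite (@PolyK _ 1) //= mulf_neq0.
Qed.

(** Expansion gives f^3 - g^2 = 2^38 3^3 (T^5 + 62T^3 - 148T^2 + 1001T - 8852), again with only 2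
    and 3 in the leading coefficient. *)
Lemma extremal4P (k : fieldType) :
  2 != 0 :> k -> 3 != 0 :> k -> extremal_pair 4 (extremal4 k).
Proof.
move=> nz2 nz3; rewrite /extremal4.
have [||||sz_f sz_g] := @cube_square_pair_deg k 4 (Poly [:: 301; - 88; 42; 0; 1])
    (- 3072 * Poly [:: - 29; 27; 1; 1]) (54 * 2 ^+ 18 * Poly [:: 13; 2; 1]) => //.
- by rewrite (@PolyK _ 1) //= oner_eq0.
- by rewrite mulNr size_polyN size_natr_mul_leq // size_Poly.
- rewrite -mulrA size_natr_mul_leq // -natrX size_natr_mul_leq //.
  exact: leq_trans (size_Poly _) _.
split=> //; rewrite /has_deg.
pose c : k := 2 ^+ 38 * 3 ^+ 3.
have nz_c: c != 0 by rewrite mulf_neq0 ?expf_neq0.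
have ->: (extremal4 k).1 ^+ 3 - (extremal4 k).2 ^+ 2
       = Poly [:: - (c * 4 * 2213); c * 1001; - (c * 148); c * 62; 0; c].
  by rewrite /extremal4 /cube_square_pair /c /= !cons_poly_def; ring.
by rewrite (@PolyK _ 1).
Qed.

(** * Centring h by a translation *)

Lemma coef_exp_XaddC (R : nzRingType) (b : R) (n : nat) :
  (('X + b%:P) ^+ n.+1)`_n = b *+ n.+1.
Proof.
elim: n => [|n IHn]; first by rewrite expr1 coefD coefX coefC add0r.
rewrite exprSr mulrDr coefD coefMX coefMC /= IHn.
have := monicXaddC b => /(monic_exp n.+1)/monicP; rewrite lead_coefE.
have ->: size (('X + b%:P) ^+ n.+1) = n.+2.
  by rewrite -[b]opprK polyCN size_exp_XsubC.
by move=> /= ->; rewrite mul1r [in RHS]mulrS addrC.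
Qed.

(** The translation by b adds (M+1)b to the coefficient of T^M, the terms of lower degree
    contributing nothing. The factor [1] matches the substitutions in [affine_scaling_equiv]. *)
Lemma monic_translation (k : fieldType) (M : nat) (h : {poly k}) :
  M.+1%:R != 0 :> k -> h \is monic -> size h = M.+2 ->
  exists b : k, (h \Po (1 *: 'X + b%:P))`_M = 0.
Proof.
move=> nz_M mon_h sz_h; pose b := - h`_M / M.+1%:R; exists b; rewrite scale1r.
pose q := h - 'X^(M.+1) - h`_M *: 'X^M.
have sz_X: size ('X + b%:P) = 2%N by rewrite size_XaddC.
have sz_q: (size q <= M)%N.
  apply/leq_sizeP=> i le_i; rewrite !coefB coefZ !coefXn.
  have [-> | ne_i] := eqVneq i M; first by rewrite ltn_eqF // mulr1 subr0 subrr.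
  have [-> | ne_iS] := eqVneq i M.+1.
    have := monicP mon_h; rewrite lead_coefE sz_h /= => ->.
    by rewrite mulr0 subr0 subrr.
  by rewrite nth_default ?sz_h; [rewrite mulr0 !subr0 | lia].
have ->: h = q + 'X^(M.+1) + h`_M *: 'X^M by rewrite /q; ring.
have ->: (q + 'X^(M.+1) + h`_M *: 'X^M) \Po ('X + b%:P)
       = (q \Po ('X + b%:P)) + ('X + b%:P) ^+ M.+1 + h`_M *: ('X + b%:P) ^+ M.
  by rewrite !comp_polyD comp_polyZ !rmorphXn /= comp_polyX.
have := monicXaddC b => /(monic_exp M)/monicP; rewrite lead_coefE.
have ->: size (('X + b%:P) ^+ M) = M.+1.
  by rewrite -[b]opprK polyCN size_exp_XsubC.
rewrite /= 2!coefD coefZ coef_exp_XaddC => ->.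
by rewrite nth_default ?size_comp_poly2 // add0r mulr1 -mulr_natr divfK // addNr.
Qed.

(** The translation is applied to h, r, s together: e and h^2 e - r^3 are then translated too, so
    their sizes do not change. *)
Lemma centered_decomposition (k : fieldType) (M : nat) (f g : {poly k}) :
  2 != 0 :> k -> M%:R != 0 :> k -> (2 < M <= 5)%N ->
  has_deg f (2 * M) -> has_deg g (3 * M) -> (size (f ^+ 3 - g ^+ 2)%R <= M.+2)%N ->
  exists h r s : {poly k},
    [/\ [/\ h \is monic, size h = M.+1, h`_M.-1 = 0, (size r <= M)%N
          & (size s <= M.-1)%N],
        affine_scaling_equiv (f, g) (cube_square_pair h r s),
        (size (3 * r ^+ 2 - 2 * s * h)%R <= M - 2)%N
      & (size (h ^+ 2 * (3 * r ^+ 2 - 2 * s * h) - r ^+ 3)%R <= M.+2)%N].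
Proof.
move=> nz2 nz_M M35 sz_f sz_g sz_D; have /andP[M3 M5] := M35.
have [|F [G [mon_F mon_G sz_F sz_G fg_FG]]] := monic_normalization sz_f sz_g.
  by apply: leq_trans sz_D _; lia.
rewrite -(size_diff_affine_scaling fg_FG) /= in sz_D.
have [h [r [s [[mon_h sz_h sz_r sz_s] def_F def_G sz_e sz_he]]]] :=
  decomposition nz2 M35 mon_F mon_G sz_F sz_G sz_D.
have [b hb0]: exists b : k, (h \Po (1 *: 'X + b%:P))`_M.-1 = 0.
  by apply: monic_translation; rewrite ?prednK //; lia.
have := size_linear b (oner_neq0 k); set q := 1 *: 'X + b%:P => sz_q.
exists (h \Po q), (r \Po q), (s \Po q).
have ->: 3 * (r \Po q) ^+ 2 - 2 * (s \Po q) * (h \Po q)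
       = (3 * r ^+ 2 - 2 * s * h) \Po q by ring.
have ->: (h \Po q) ^+ 2 * ((3 * r ^+ 2 - 2 * s * h) \Po q) - (r \Po q) ^+ 3
       = (h ^+ 2 * (3 * r ^+ 2 - 2 * s * h) - r ^+ 3) \Po q by ring.
rewrite !size_comp_poly2 //; split=> //.
- split=> //; rewrite monicE lead_coef_comp ?sz_q // (monicP mon_h) mul1r.
  by rewrite lead_coefE sz_q !coefE /= mulr1 addr0 expr1n.
apply: affine_scaling_trans fg_FG _; rewrite def_F def_G.
apply: (@cube_square_pair_equiv _ h r s _ _ _ 1 b 0); first exact: oner_neq0.
all: by rewrite !expr1n [RHS]scale1r.
Qed.

(** * Classification up to equivalence *)

Lemma cube_sub_square_eq0 (k : fieldType) (f g h r s : {poly k}) :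
  affine_scaling_equiv (f, g) (cube_square_pair h r s) -> r = 0 -> s = 0 ->
  f ^+ 3 = g ^+ 2.
Proof.
move=> /size_diff_affine_scaling /= sz_fg r_0 s_0.
apply/eqP; rewrite -subr_eq0 -size_poly_eq0 -sz_fg size_poly_eq0 r_0 s_0.
by apply/eqP; ring.
Qed.

Lemma classification3 (k : closedFieldType) (f g : {poly k}) :
  2 != 0 :> k -> 3 != 0 :> k -> has_deg f 6 -> has_deg g 9 ->
  (size (f ^+ 3 - g ^+ 2)%R <= 5)%N ->
  f ^+ 3 = g ^+ 2 \/ affine_scaling_equiv (extremal3 k) (f, g).
Proof.
move=> nz2 nz3 sz_f sz_g sz_D.
have [h [r [s [[mon_h sz_h h2_0 sz_r sz_s] fg_hrs sz_e sz_he]]]] :=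
  @centered_decomposition k 3 _ _ nz2 nz3 isT sz_f sz_g sz_D.
have [[r_0 s_0] | [u nz_u [Eh Er Es]]] :=
    depressed_solution3 nz2 nz3 mon_h sz_h h2_0 sz_r sz_s sz_e sz_he.
  by left; apply: cube_sub_square_eq0 fg_hrs r_0 s_0.
right; apply: affine_scaling_sym; apply: affine_scaling_trans fg_hrs _.
(* Since u has weight 2, moving it to 1 by T -> aT takes a square root of u; this is where algebraic
   closure enters. *)
have [a def_u]: exists a, u = a ^+ 2.
  have /closed_rootP[a]: size ('X^2 - u%:P) != 1%N by rewrite size_XnsubC.
  by move=> /rootP; rewrite !hornerE => /subr0_eq <-; exists a.
have nz_a: a != 0 by apply: contraNneq nz_u => a_0; rewrite def_u a_0 expr0n.
apply: (@cube_square_pair_equiv _ _ _ _ _ _ _ a 0 3 nz_a);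
  rewrite ?Eh ?Er ?Es def_u /= !cons_poly_def;
  rewrite !(comp_polyD, comp_polyM, comp_polyX, comp_polyC, polyC0) -!mul_polyC;
  by ring.
Qed.

Lemma classification4 (k : fieldType) (f g : {poly k}) :
  2 != 0 :> k -> 3 != 0 :> k -> has_deg f 8 -> has_deg g 12 ->
  (size (f ^+ 3 - g ^+ 2)%R <= 6)%N ->
  f ^+ 3 = g ^+ 2 \/ affine_scaling_equiv (extremal4 k) (f, g).
Proof.
move=> nz2 nz3 sz_f sz_g sz_D.
have nz4: 4 != 0 :> k by rewrite (_ : 4 = 2 * 2) ?mulf_neq0 //; ring.
have [h [r [s [[mon_h sz_h h3_0 sz_r sz_s] fg_hrs sz_e sz_he]]]] :=
  @centered_decomposition k 4 _ _ nz2 nz4 isT sz_f sz_g sz_D.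
have [[r_0 s_0] | [a nz_a [Eh Er Es]]] :=
    depressed_solution4 nz2 nz3 mon_h sz_h h3_0 sz_r sz_s sz_e sz_he.
  by left; apply: cube_sub_square_eq0 fg_hrs r_0 s_0.
right; apply: affine_scaling_sym; apply: affine_scaling_trans fg_hrs _.
apply: (@cube_square_pair_equiv _ _ _ _ _ _ _ a 0 4 nz_a);
  rewrite ?Eh ?Er ?Es -!mul_polyC /= !cons_poly_def;
  rewrite !(comp_polyD, comp_polyM, comp_polyX, comp_polyC, polyC0);
  by ring.
Qed.

Theorem theorem2 (k : closedFieldType)
    (hchar2 : 2%N \notin [pchar k]) (hchar3 : 3%N \notin [pchar k])
    (M : nat) (hM : M = 3%N \/ M = 4%N) :
  (forall f g : {poly k},
     has_deg f (2 * M) -> has_deg g (3 * M) -> f ^+ 3 <> g ^+ 2 ->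
     exists2 d : nat, has_deg (f ^+ 3 - g ^+ 2) d & (M.+1 <= d)%N)
  /\
  (exists2 fg0 : {poly k} * {poly k}, extremal_pair M fg0
     & forall fg : {poly k} * {poly k},
         extremal_pair M fg -> affine_scaling_equiv fg0 fg).
Proof.
have nz2: 2 != 0 :> k by move: hchar2; rewrite inE.
have nz3: 3 != 0 :> k by move: hchar3; rewrite inE.
(* Both claims follow from one classification covering all degrees up to M + 1, not only M + 1
   itself. *)
have [fg0 ext0 classify]: exists2 fg0 : {poly k} * {poly k}, extremal_pair M fg0
    & forall f g : {poly k}, has_deg f (2 * M) -> has_deg g (3 * M) ->
      (size (f ^+ 3 - g ^+ 2)%R <= M.+2)%N ->
      f ^+ 3 = g ^+ 2 \/ affine_scaling_equiv fg0 (f, g).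
  case: hM => ->.
    by exists (extremal3 k) => [|f g *]; [apply: extremal3P | apply: classification3].
  by exists (extremal4 k) => [|f g *]; [apply: extremal4P | apply: classification4].
have [_ _ sz0] := ext0.
split=> [f g sz_f sz_g ne_fg | ].
  have nz_D: f ^+ 3 - g ^+ 2 != 0 by rewrite subr_eq0; apply/eqP.
  have sz_D: (M.+2 <= size (f ^+ 3 - g ^+ 2)%R)%N.
    (* A smaller degree would place (f, g) in the orbit of [fg0], where the degree is M + 1. *)
    rewrite leqNgt; apply/negP=> lt_D.
    have [//|/size_diff_affine_scaling /= eq_sz] := classify f g sz_f sz_g (ltnW lt_D).
    by rewrite eq_sz sz0 ltnn in lt_D.
  exists (size (f ^+ 3 - g ^+ 2)%R).-1; last by rewrite -ltnS prednK ?size_poly_gt0.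
  by rewrite /has_deg prednK // size_poly_gt0.
exists fg0 => // -[f g] [/= sz_f sz_g sz_D].
have [|eq_fg|//] := classify f g sz_f sz_g; first by rewrite sz_D.
by move: sz_D; rewrite /has_deg eq_fg subrr size_poly0.
Qed.
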